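(* Let $n,m\ge1$. A function $f:\mathbb{Z}/n\mathbb{Z}\to\mathbb{Z}/m\mathbb{Z}$ is congruence preserving if and only if there exist $p<\min(n,\mu(m))$ and $a_0,\dots,a_p\in\mathbb{Z}/m\mathbb{Z}$ such that $f(x)=\sum_{k=0}^{p}a_k\,\big(\binom{x}{k}\bmod m\big)$ for all $x\in\{0,\dots,n-1\}$ and, for all $k\le p$, $\mathrm{lcm}(k)$ divides $a_k$ in $\mathbb{Z}/m\mathbb{Z}$.
   Context: Elements of $\mathbb{Z}/n\mathbb{Z}$ are represented by $\{0,\dots,n-1\}$. A function $f:\mathbb{Z}/n\mathbb{Z}\to\mathbb{Z}/m\mathbb{Z}$ is congruence preserving if for every positive divisor $d$ of $m$ and all $a,b\in\{0,\dots,n-1\}$, $a\equiv b\pmod d$ implies $f(a)\equiv f(b)\pmod d$. For $k\ge1$, $\mathrm{lcm}(k)$ is the least common multiple of $1,\dots,k$, and $\mathrm{lcm}(0)=1$; it is viewed as an element of $\mathbb{Z}/m\mathbb{Z}$, and $c$ divides $a$ in $\mathbb{Z}/m\mathbb{Z}$ if $a=ct$ for some $t\in\mathbb{Z}/m\mathbb{Z}$. For $m$ with prime factorization $m=p_1^{\alpha_1}\cdots p_\ell^{\alpha_\ell}$, $\mu(m)=\max_{i}p_i^{\alpha_i}$ is the largest prime power dividing $m$. *)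

(* Defs.v *)
From HB Require Import structures.
From mathcomp Require Import all_boot all_order all_algebra.
Set Implicit Arguments.
Unset Strict Implicit.
Unset Printing Implicit Defensive.

(* Z/mZ is the type 'I_m of representatives {0, ..., m-1}.  The notation 'Z_m
   is avoided because 'Z_1 denotes Z/2Z.  For a modulus of the form m.+1,
   addition is the library's zmodType structure on 'I_m.+1, multiplication is
   Zp_mul, and reduction of a natural number is inZp. *)

(* Congruences are between the representatives, as natural numbers. *)
Definition congruence_preserving (n m : nat) (f : 'I_n -> 'I_m) : Prop :=
  forall d : nat, 0 < d -> d %| m ->
  forall a b : 'I_n, a = b %[mod d] -> f a = f b %[mod d].

Definition lcm_upto (k : nat) : nat := \big[lcmn/1]_(1 <= i < k.+1) i.

(* The default value 1 of the maximum matters only for m = 1, which has no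
   prime factor and whose largest prime-power divisor is p ^ 0 = 1. *)
Definition mu (m : nat) : nat := \big[maxn/1]_(p <- primes m) p ^ logn p m.

Definition Zp_dvd (m : nat) (c a : 'I_m) : Prop := exists t : 'I_m, a = Zp_mul c t.

(* Main.v *)
Require Import Defs.
From mathcomp Require Import all_boot all_order all_algebra.
Set Implicit Arguments.
Unset Strict Implicit.
Unset Printing Implicit Defensive.

(** For every [d > 0], Vandermonde's identity and [i * 'C(d, i) = d * 'C(d.-1, i.-1)]
    show that [lcm(k) * 'C(x, k)] is [d]-periodic modulo [d]; hence a combination of
    binomials whose [k]-th coefficient is a multiple of [lcm(k)] preserves congruences.

    Conversely, the coefficients are found one at a time.  If the partial sum [S] agrees
    with [f] below [K], then for every [d <= K] dividing [m] the congruence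
    [K = K - d (mod d)] gives [f(K) = f(K - d) = S(K - d) = S(K) (mod d)].  Applied to
    [d = gcd(i, m)] for [i <= K] this yields [f(K) = S(K)] modulo [gcd(lcm(K), m)], so the
    next coefficient can be taken in the multiples of [lcm(K)].  Once [K >= mu(m)], it
    applies to every maximal prime power of [m], so [f(K) = S(K) (mod m)] already. *)

Lemma lcm_uptoS k : lcm_upto k.+1 = lcmn (lcm_upto k) k.+1.
Proof. by rewrite /lcm_upto big_nat_recr. Qed.

Lemma dvdn_lcm_upto i k : 0 < i <= k -> i %| lcm_upto k.
Proof.
elim: k => [|k IHk] /andP[i_gt0]; first by rewrite leqn0 => /eqP i0; rewrite i0 in i_gt0.
rewrite lcm_uptoS leq_eqVlt => /orP[/eqP-> | lt_ik]; first exact: dvdn_lcmr.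
by apply: dvdn_trans (dvdn_lcml _ _); apply: IHk; rewrite i_gt0.
Qed.

(** Gcd distributes over lcm, so [gcdn (lcm_upto k) m] is the lcm of the [gcdn i m] for
    [0 < i <= k]. *)
Lemma gcdn_lcm_upto_dvd k m r :
  (forall i, 0 < i <= k -> gcdn i m %| r) -> gcdn (lcm_upto k) m %| r.
Proof.
elim: k => [|k IHk] dvd_r; first by rewrite /lcm_upto big_geq // gcd1n dvd1n.
rewrite lcm_uptoS Order.NatDvd.meetUl dvdn_lcm (dvd_r k.+1) ?leqnn // andbT.
by apply: IHk => i /andP[i_gt0 le_ik]; rewrite dvd_r // i_gt0 leqW.
Qed.

Lemma dvdn_lcm_upto_bin d k i : 0 < i <= k -> d %| lcm_upto k * 'C(d, i).
Proof.
move=> ik; have /dvdnP[s ->] := dvdn_lcm_upto ik.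
case: i d ik => // i [|d] _; first by rewrite bin0n muln0.
by rewrite -mulnA -mul_bin_diag mulnCA dvdn_mulr.
Qed.

Lemma lcm_upto_bin_periodic d k x :
  lcm_upto k * 'C(d + x, k) = lcm_upto k * 'C(x, k) %[mod d].
Proof.
(* The term of index 0 is ['C(x, k)]; every other term has a factor ['C(d, i)] with [0 < i <= k]. *)
rewrite -binomial.Vandermonde big_ord_recl bin0 mul1n subn0 mulnDr.
set S := \sum_(i < k) _.
suff /eqP dS : d %| lcm_upto k * S by rewrite -modnDmr dS addn0.
rewrite big_distrr /=; apply: dvdn_sum => i _.
by rewrite mulnA dvdn_mulr // dvdn_lcm_upto_bin /=.
Qed.

Lemma periodic_congr (F : nat -> nat) d :
  (forall x, F (d + x) = F x %[mod d]) ->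
  forall x y, x = y %[mod d] -> F x = F y %[mod d].
Proof.
move=> Fd; have Fmod x : F x = F (x %% d) %[mod d].
  rewrite {1}(divn_eq x d); elim: (x %/ d) => // j IHj.
  by rewrite mulSn -addnA Fd.
by move=> x y xy; rewrite Fmod xy -Fmod.
Qed.

(** Natural coefficients let one sum be reduced modulo every [d]; the factor [lcm_upto k] builds in
    the required divisibility. *)
Definition lcm_newton (t : nat -> nat) (K x : nat) : nat :=
  \sum_(k < K) lcm_upto k * t k * 'C(x, k).

Lemma lcm_newton_congr t K d x y :
  x = y %[mod d] -> lcm_newton t K x = lcm_newton t K y %[mod d].
Proof.
apply: periodic_congr => {x y}x.
rewrite /lcm_newton; elim/big_rec2: _ => // k u v _ uv.
by rewrite -modnDm uv mulnAC -modnMml lcm_upto_bin_periodic modnMml modnDm mulnAC.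
Qed.

(** Modulo [d], [m - y] stands for the opposite of [y], which avoids truncated differences. *)
Lemma dvdn_add_subn_mod d m x y : d %| m -> y <= m ->
  (d %| x + (m - y)) = (x == y %[mod d]).
Proof.
move=> dm le_ym; rewrite -(eqn_modDr (m - y)) subnKC //.
by rewrite (eqP dm).
Qed.

Lemma eqn_mod_gcd_solve L m x y : 0 < m -> y <= m -> x = y %[mod gcdn L m] ->
  exists t, x + L * t = y %[mod m].
Proof.
move=> m_gt0 le_ym xy.
have: gcdn L m %| x + (m - y) by rewrite dvdn_add_subn_mod ?dvdn_gcdr //; apply/eqP.
case/dvdnP=> s Es; have [a _ ma] := Bezoutl L m_gt0.
(* Modulo [m], [a * L] is minus the gcd and [x - y] is [s] times the gcd, so adding [L * (a * s)] to
   [x] gives [y]. *)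
exists (a * s); apply/eqP; rewrite -(@dvdn_add_subn_mod _ m) // addnAC Es.
by rewrite mulnCA mulnA [s * _]mulnC -mulnDl gcdnC dvdn_mulr.
Qed.

Lemma mu_gt0 m : 0 < mu m.
Proof. by rewrite /mu; elim/big_rec: _ => // i x _ x0; rewrite leq_max x0 orbT. Qed.

Lemma part_le_mu m p : p \in primes m -> p ^ logn p m <= mu m.
Proof. by move=> pm; rewrite /mu (bigD1_seq p) ?primes_uniq //= leq_maxl. Qed.

Lemma lcm_newton_congr_next (F : nat -> nat) m t K d x :
    0 < d <= x -> d %| m ->
    (forall y, y < x -> y = x %[mod d] -> F y = F x %[mod d]) ->
    (forall y, y < x -> lcm_newton t K y = F y %[mod m]) ->
  lcm_newton t K x = F x %[mod d].
Proof.
move=> /andP[d_gt0 le_dx] dm Fcongr agree.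
have xd : x - d = x %[mod d] by rewrite -{2}(subnK le_dx) modnDr.
have lt_xdx : x - d < x by rewrite ltn_subrL d_gt0 (leq_trans d_gt0).
rewrite -(lcm_newton_congr t K xd) -(Fcongr _ lt_xdx xd).
by rewrite -(modn_dvdm _ dm) agree // modn_dvdm.
Qed.

Lemma lcm_newton_interpolation (F : nat -> nat) m K :
    0 < m -> (forall x, F x <= m) ->
    (forall d x y, 0 < d -> d %| m -> x < K -> y < K ->
       x = y %[mod d] -> F x = F y %[mod d]) ->
  exists t, forall x, x < K -> lcm_newton t K x = F x %[mod m].
Proof.
move=> m_gt0 F_le; elim: K => [|K IHK] Fcongr; first by exists id.
have [d x y d0 dm lt_x lt_y|t agree] := IHK.
  by apply: Fcongr; rewrite // ltnW.
have: lcm_newton t K K = F K %[mod gcdn (lcm_upto K) m].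
  apply/eqP; rewrite -(@dvdn_add_subn_mod _ m) ?dvdn_gcdr //.
  apply: gcdn_lcm_upto_dvd => i /andP[i_gt0 le_iK].
  rewrite dvdn_add_subn_mod ?dvdn_gcdr //; apply/eqP.
  have d_gt0 : 0 < gcdn i m by rewrite gcdn_gt0 i_gt0.
  apply: (lcm_newton_congr_next (m := m)) agree; rewrite ?dvdn_gcdr //.
    by rewrite d_gt0 (leq_trans (dvdn_leq _ (dvdn_gcdl i m))).
  by move=> y lt_yK; apply: Fcongr; rewrite ?dvdn_gcdr // ltnW.
case/(eqn_mod_gcd_solve m_gt0 (F_le K)) => c Ec.
(* The new term vanishes below [K], where ['C(x, K) = 0], and equals [lcm_upto K * c] at [K]. *)
exists (fun k => if k == K then c else t k) => x.
have newtonS : lcm_newton (fun k => if k == K then c else t k) K.+1 x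
             = lcm_newton t K x + lcm_upto K * c * 'C(x, K).
  rewrite /lcm_newton big_ord_recr /= eqxx; congr (_ + _).
  by apply: eq_bigr => k _; rewrite ltn_eqF.
rewrite newtonS ltnS leq_eqVlt => /orP[/eqP-> | lt_xK]; first by rewrite binn muln1.
by rewrite bin_small // muln0 addn0 agree.
Qed.

Lemma lcm_newton_extend (F : nat -> nat) m n t K :
    0 < m -> (forall x, F x <= m) -> minn n (mu m) <= K ->
    (forall d x y, 0 < d -> d %| m -> x < n -> y < n ->
       x = y %[mod d] -> F x = F y %[mod d]) ->
    (forall x, x < K -> lcm_newton t K x = F x %[mod m]) ->
  forall x, x < n -> lcm_newton t K x = F x %[mod m].
Proof.
move=> m_gt0 F_le le_K Fcongr agree; elim/ltn_ind => x IHx lt_xn.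
have [/agree // | le_Kx] := ltnP x K.
have le_mu_x : mu m <= x.
  by move: (leq_trans le_K le_Kx); rewrite geq_min leqNgt lt_xn.
(* Each maximal prime power of [m] is at most [mu m <= x], so one can step back from [x] by it. *)
apply/eqP; rewrite -(@dvdn_add_subn_mod _ m) //; apply/dvdn_partP => // p pm.
rewrite dvdn_add_subn_mod ?dvdn_part //; apply/eqP.
apply: (lcm_newton_congr_next (m := m)); rewrite ?dvdn_part //.
- by rewrite part_gt0 p_part (leq_trans (part_le_mu _)).
- by move=> y lt_yx; apply: Fcongr; rewrite ?part_gt0 ?dvdn_part // (ltn_trans lt_yx).
- by move=> y lt_yx; apply: IHx => //; apply: ltn_trans lt_xn.
Qed.

Lemma Zp_mul_inZp m a b : Zp_mul (inZp a) (inZp b) = inZp (a * b) :> 'I_m.+1.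
Proof. by apply: val_inj; rewrite /= modnMm. Qed.

Lemma Zp_dvdP m c (a : 'I_m.+1) : Zp_dvd (inZp c) a <-> exists t, a = inZp (c * t).
Proof.
split=> [[t ->]|[t ->]]; first by exists t; rewrite -{1}[t]valZpK Zp_mul_inZp.
by exists (inZp t); rewrite Zp_mul_inZp.
Qed.

Lemma sum_inZp m K (u : 'I_K -> nat) :
  (\sum_(k < K) inZp (u k))%R = inZp (\sum_(k < K) u k) :> 'I_m.+1.
Proof.
apply: esym; apply: (big_morph inZp) => [x y|]; last exact: val_inj.
by apply: val_inj; rewrite /= modnDm.
Qed.

Lemma sum_lcm_newton m p (t : nat -> nat) x :
  (\sum_(k < p) Zp_mul (inZp (lcm_upto k * t k)) (inZp 'C(x, k)))%R
  = inZp (lcm_newton t p x) :> 'I_m.+1.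
Proof.
by rewrite -sum_inZp; apply: eq_bigr => k _; rewrite Zp_mul_inZp.
Qed.

(* The moduli n, m >= 1 of the source are n.+1 and m.+1 here. *)
Theorem theorem3p12 (n m : nat) (f : 'I_n.+1 -> 'I_m.+1) :
  congruence_preserving f <->
  exists (p : nat) (a : 'I_p.+1 -> 'I_m.+1),
    [/\ p < minn n.+1 (mu m.+1),
        forall x : 'I_n.+1,
          f x = (\sum_(k < p.+1) Zp_mul (a k) (inZp 'C(x, k)))%R
      & forall k : 'I_p.+1, Zp_dvd (inZp (lcm_upto k)) (a k)].
Proof.
split=> [f_cp | [p [a [_ fE a_dvd]]] d d_gt0 dm x y xy]; last first.
  have /fin_all_exists[t aE] (k : 'I_p.+1) := (Zp_dvdP (lcm_upto k) (a k)).1 (a_dvd k).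
  (* [inord] extends [t] from the indices [k <= p] to all naturals. *)
  have fN z : f z = inZp (lcm_newton (t \o inord) p.+1 z).
    by rewrite fE -sum_lcm_newton; apply: eq_bigr => k _; rewrite aE /= inord_val.
  by rewrite !fN /= !modn_dvdm //; apply: lcm_newton_congr.
(* Beyond [n], [inord] defaults to 0 and [F] is constantly [f 0]; congruences for [F] are claimed
   only up to [n]. *)
pose F x := val (f (inord x)).
have F_le x : F x <= m.+1 by exact: ltnW (ltn_ord _).
have Fcongr d x y : 0 < d -> d %| m.+1 -> x < n.+1 -> y < n.+1 ->
    x = y %[mod d] -> F x = F y %[mod d].
  by move=> d0 dm ltx lty xy; apply: f_cp; rewrite // !inordK.
have P_gt0 : 0 < minn n.+1 (mu m.+1) by rewrite leq_min mu_gt0.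
(* Interpolating at the [p.+1] points [0, ..., p] gives degree at most [p], just below the
   minimum. *)
case EP: (minn n.+1 (mu m.+1)) P_gt0 => [//|p] _.
have lt_pn : p < n.+1 by rewrite -EP geq_minl.
have [d x y d0 dm ltx lty|t agree] := @lcm_newton_interpolation F m.+1 p.+1 isT F_le.
  by apply: Fcongr => //; [apply: leq_trans ltx _ | apply: leq_trans lty _].
have {}agree := @lcm_newton_extend F m.+1 n.+1 t p.+1 isT F_le (eq_leq EP) Fcongr agree.
exists p, (fun k => inZp (lcm_upto k * t k)); split=> // [x | k]; last first.
  by apply/Zp_dvdP; exists (t k).
rewrite sum_lcm_newton; apply: val_inj; rewrite /= agree // /F inord_val.
by rewrite (modn_small (ltn_ord _)).
Qed.
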